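(* Let $k\ge1$, let $\vec s=(n_1,\dots,n_k)$ be a tuple of positive integers, $p\ge1$ and $0\le j\le p$. An index $m=(m_1,\dots,m_k)\in I_p$ is missing from the $(p,j)$-horn (i.e. $m\in M_{p,j}$) if and only if $\operatorname{im}(m)\supseteq F_j$, where $\operatorname{im}(m)=\{m_1,\dots,m_k\}$ and $F_j=\{0,\dots,p\}\setminus\{j\}$.
   Context: Notation: $[p]=\{0,\dots,p\}$. For a shape $\vec s=(n_1,\dots,n_k)$ put $n=\min(n_1,\dots,n_k)-1$, $M_a(p)=n_a-1-n+p$ (so $M_a(p)\ge p$) and $I_p=\prod_{a=1}^k[M_a(p)]$ for $p\ge 0$. Let $\delta_i^q:[q-1]\to[q]$ be the increasing injection missing $i$, and $\Delta_i^p=\prod_{a=1}^k\delta_i^{M_a(p)}:I_{p-1}\to I_p$ ($p\ge1$, $0\le i\le p$). An index $m\in I_p$ is missing from the $(p,j)$-horn if $m\notin\operatorname{im}(\Delta_i^p)$ for all $i\in F_j$; $M_{p,j}\subset I_p$ denotes the set of missing indices. *)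

(* Defs.v *)
From mathcomp Require Import all_boot.

Set Implicit Arguments.
Unset Strict Implicit.
Unset Printing Implicit Defensive.

(* [q] = {0, ..., q} is the type 'I_q.+1. *)

(* The default value of the iterated minimum is an entry of s as soon as s is
   nonempty, so for 0 < k this is the minimum of the entries, minus one. *)
Definition shape_dim k (s : k.-tuple nat) : nat :=
  (\big[minn/head 0 s]_(x <- s) x).-1.

(* M_a(p) = n_a - 1 - n + p. The subtractions are exact when all the entries
   are positive; p comes first so that M_a(p.+1) is convertible to M_a(p).+1. *)
Definition width k (s : k.-tuple nat) (p : nat) (a : 'I_k) : nat :=
  p + (tnth s a - 1 - shape_dim s).

Lemma width_ge k (s : k.-tuple nat) (p : nat) (a : 'I_k) :
  p.+1 <= (width s p a).+1.
Proof. by rewrite ltnS leq_addr. Qed.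

Definition index_set k (s : k.-tuple nat) (p : nat) : finType :=
  {dffun forall a : 'I_k, 'I_(width s p a).+1}.

Definition delta (q : nat) (i : 'I_q.+1) : 'I_q -> 'I_q.+1 := lift i.

(* Delta_i^(p+1) : I_p -> I_(p+1), for 0 <= i <= p + 1. *)
Definition Delta k (s : k.-tuple nat) (p : nat) (i : 'I_p.+2)
    (m : index_set s p) : index_set s p.+1 :=
  [ffun a : 'I_k =>
     @delta (width s p.+1 a) (widen_ord (width_ge s p.+1 a) i) (m a)].

Definition faces (p : nat) (j : 'I_p.+1) : {set 'I_p.+1} := [set~ j].

(* M_(p+1,j). *)
Definition missing k (s : k.-tuple nat) (p : nat) (j : 'I_p.+2) :
    {set index_set s p.+1} :=
  [set m | [forall i in faces j, m \notin codom (@Delta k s p i)]].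

(* The entries of m live in different ordinals; they are compared in nat. *)
Definition im k (s : k.-tuple nat) (p : nat) (m : index_set s p) : seq nat :=
  [seq nat_of_ord (m a) | a : 'I_k].

(* Main.v *)
Require Import Defs.
From mathcomp Require Import all_boot.

(** In every coordinate the image of [delta] is everything except [i], and a product map is inverted
    coordinatewise; so [m] lies on the [i]-th face exactly when no entry of [m] equals [i]
    ([codom_Delta]). Negating this for each [i] in [faces j] gives the criterion. *)

Lemma codom_Delta (k : nat) (s : k.-tuple nat) (p : nat) (i : 'I_p.+2)
    (m : index_set s p.+1) :
  (m \in codom (@Delta k s p i)) = (nat_of_ord i \notin im m).
Proof.
apply/codomP/idP => [[m' ->]|i_notin].
  apply/negP => /codomP[a]; rewrite ffunE /= => i_eq.
  by have := neq_bump i (m' a); rewrite -i_eq eqxx.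
pose h a : 'I_(width s p.+1 a).+1 := widen_ord (width_ge s p.+1 a) i.
(* The preimage undoes the lift in each coordinate. The default [ord0] is never reached: [unlift]
   fails only if [m a] equals [h a], which would make [i] an entry of [m]. *)
pose m' : index_set s p := [ffun a : 'I_k => odflt ord0 (unlift (h a) (m a))].
exists m'; apply/ffunP => a; rewrite !ffunE /delta -/(h a).
case: unliftP => [b ->|m_eq] //=.
by case/negP: i_notin; apply/codomP; exists a; rewrite m_eq.
Qed.

Theorem proposition3p8 (k : nat) (s : k.-tuple nat) (p : nat) (j : 'I_p.+2)
    (m : index_set s p.+1) :
  0 < k -> (forall a : 'I_k, 0 < tnth s a) ->
  m \in missing s j <-> {subset [seq nat_of_ord i | i in faces j] <= im m}.
Proof.
move=> _ _; rewrite inE; split=> [/forall_inP missing_m _ /imageP[i Fi ->]|im_m].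
  by have := missing_m i Fi; rewrite codom_Delta negbK.
apply/forall_inP => i Fi; rewrite codom_Delta negbK.
by apply/im_m/imageP; exists i.
Qed.
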